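(* Let $k\ge1$ be an integer, $\lambda>0$, $0<\alpha\le2$, and $\theta\in\mathbf{R}$ with $|\theta|\le\min(\pi\alpha/2,\ \pi-\pi\alpha/2)$. Then the generalized Linnik law GL$(\alpha,\theta,1/k)$, i.e. the probability law on $\mathbf{R}$ with characteristic function $$\phi(u)=\frac{1}{\left[1+\lambda|u|^{\alpha}e^{-i\theta\,\mathrm{sgn}(u)}\right]^{1/k}},\qquad u\in\mathbf{R},$$ is absolutely continuous (with respect to Lebesgue measure).
   Context: The root is the principal branch. It is known that the displayed function is a characteristic function for the stated parameters. *)

(* Defs.v *)
From mathcomp Require Import all_boot all_order all_algebra.
From mathcomp Require Import all_classical all_reals all_analysis.
From mathcomp Require Import complex.

Set Implicit Arguments.
Unset Strict Implicit.
Unset Printing Implicit Defensive.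

Import Order.TTheory GRing.Theory Num.Theory.
Import numFieldNormedType.Exports.

Local Open Scope ring_scope.
Local Open Scope complex_scope.

Section ComplexPower.
Context {R : realType}.
Implicit Types z : R[i].

Definition expi (t : R) : R[i] := cos t +i* sin t.

(* Principal argument, in ]-pi, pi]; the value at 0 is irrelevant. *)
Definition principal_arg z : R :=
  let t := acos (complex.Re z / Normc.normc z) in
  if 0 <= complex.Im z then t else - t.

(* Principal branch of z^s, that is exp (s * Log z), for z != 0 and real s.
   MathComp's own n.-root is not the principal branch: it picks the root of
   least nonnegative argument. *)
Definition principal_pow z (s : R) : R[i] :=
  (Normc.normc z `^ s)%:C * expi (s * principal_arg z).

End ComplexPower.

(* The complex-valued integral of exp (i u x), taken componentwise. *)
Definition char_fun {R : realType} (P : probability (measurableTypeR R) R)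
    (u : R) : R[i] :=
  (\int[P]_x cos (u * x)) +i* (\int[P]_x sin (u * x)).

Definition linnik_cf {R : realType} (lambda alpha theta nu u : R) : R[i] :=
  (principal_pow
    (1 + (lambda * `|u| `^ alpha)%:C * expi (- (theta * Num.sg u))) nu)^-1.

Definition is_generalized_linnik {R : realType} (lambda alpha theta nu : R)
    (P : probability (measurableTypeR R) R) : Prop :=
  forall u : R, char_fun P u = linnik_cf lambda alpha theta nu u.

(* Main.v *)
Require Import Defs.
From mathcomp Require Import all_boot all_order all_algebra.
From mathcomp Require Import all_classical all_reals all_analysis.
From mathcomp Require Import measurable_realfun complex ring lra.
Import Order.TTheory GRing.Theory Num.Theory.
Import numFieldNormedType.Exports.
Local Open Scope ring_scope.

(** On the integers, the characteristic function has the polar form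
    A_n e^{-i T_n}, where the modulus A_n decreases to 0 and the phase T_n is
    monotone and bounded: as r grows, the point 1 + r e^{-i theta} moves along a
    ray with cos theta >= 0, so that its modulus and its angle are monotone.
    Hence the sequence (phi(n)) has bounded variation and tends to 0, and this
    alone gives absolute continuity. Indeed, 1 - cos X times a Fejer kernel has
    an expectation which is controlled by the differences phi(n) - phi(n+1), so
    that the law of X weighted by 1 - cos x has a bounded density; and
    P(cos X = 1) is bounded by Cesaro means of |phi(n)|, as in Wiener's theorem
    on atoms. *)

(** * Lipschitz bounds for cosine and sine, and the Fejer kernel *)

Section Trigonometry.
Context {R : realType}.
Implicit Types (x y t : R) (n N : nat).

Lemma lipschitz1_of_derive (f df : R -> R) :
  (forall x, is_derive x 1 f (df x)) -> (forall x, `|df x| <= 1) ->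
  forall x y, `|f x - f y| <= `|x - y|.
Proof.
move=> fdf df1.
have cf : continuous f.
  by move=> x; apply/differentiable_continuous/derivable1_diffP.
suff le_case x y : x <= y -> `|f x - f y| <= `|x - y|.
  move=> x y; have [/le_case //|/ltW/le_case] := leP x y.
  by rewrite distrC [leRHS]distrC.
move=> xy.
have [|c _ e] := @MVT_segment _ f df x y xy (fun z _ => fdf z).
  exact: continuous_subspaceT.
rewrite distrC e normrM [leRHS]distrC -[leRHS]mul1r.
by rewrite ler_wpM2r.
Qed.

Lemma sin_le_norm1 x : `|sin x| <= 1.
Proof. by rewrite ler_norml sin_geN1 sin_le1. Qed.

Lemma cos_le_norm1 x : `|cos x| <= 1.
Proof. by rewrite ler_norml cos_geN1 cos_le1. Qed.

Lemma cos_lipschitz x y : `|cos x - cos y| <= `|x - y|.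
Proof.
apply: (@lipschitz1_of_derive _ (fun x => - sin x)) => z.
by rewrite normrN sin_le_norm1.
Qed.

Lemma sin_lipschitz x y : `|sin x - sin y| <= `|x - y|.
Proof.
by apply: (@lipschitz1_of_derive _ cos) => z; exact: cos_le_norm1.
Qed.

(** Used with cosine and sine for one step of a polar sequence: the loss of modulus and the change
    of phase are charged separately, so that the bounds telescope when summed. *)
Lemma norm_scaledB_le (g : R -> R) (m m' x y : R) :
  (forall x, `|g x| <= 1) -> (forall x y, `|g x - g y| <= `|x - y|) ->
  0 <= m' -> m' <= m -> m' <= 1 ->
  `|m * g x - m' * g y| <= (m - m') + `|x - y|.
Proof.
move=> g1 gL m'0 m'm m'1.
have -> : m * g x - m' * g y = (m - m') * g x + m' * (g x - g y) by ring.
rewrite (le_trans (ler_normD _ _))// !normrM (ger0_norm m'0).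
rewrite (ger0_norm (_ : 0 <= m - m')) ?subr_ge0// lerD//.
  by rewrite ler_piMr// subr_ge0.
by rewrite (le_trans _ (gL x y))// ler_piMl.
Qed.

Lemma cos_natmul1 x n : cos x = 1 -> cos (n%:R * x) = 1.
Proof.
move=> cx; have sx : sin x = 0.
  by apply/eqP; rewrite -sqrf_eq0 sin2cos2 cx expr1n subrr.
elim: n => [|n IH]; first by rewrite mul0r cos0.
by rewrite -natr1 mulrDl mul1r cosD IH cx sx mulr0 subr0 mulr1.
Qed.

(* [N] times the classical Fejer kernel. *)
Definition fejer N y : R :=
  \sum_(m < N) (1 + (\sum_(j < m) cos (j.+1%:R * y)) *+ 2).

(** The right-hand side is the squared modulus of S_N, the sum of e^{iny} over n < N. Passing to N +
    1 adds 1 + 2 Re(e^{iNy} conj(S_N)), which is the next summand of the kernel. *)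
Lemma fejerE N y : fejer N y =
  (\sum_(n < N) cos (n%:R * y)) ^+ 2 + (\sum_(n < N) sin (n%:R * y)) ^+ 2.
Proof.
rewrite /fejer; elim: N => [|N IH]; first by rewrite !big_ord0; ring.
rewrite !big_ord_recr/= IH.
set c := \sum_(n < N) cos _; set s := \sum_(n < N) sin _.
have -> : \sum_(j < N) cos (j.+1%:R * y) =
    cos (N%:R * y) * c + sin (N%:R * y) * s.
  (* Reversing the order of summation turns the frequency j + 1 into N - n, to which the subtraction
     formula applies. *)
  rewrite !mulr_sumr -big_split/= (reindex_inj rev_ord_inj)/=.
  apply: eq_bigr => n _; rewrite -cosB subnSK//.
  by rewrite natrB 1?ltnW// mulrBl.
by have := cos2Dsin2 (N%:R * y); lra.
Qed.

Lemma fejer_ge0 N y : 0 <= fejer N y.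
Proof. by rewrite fejerE addr_ge0// sqr_ge0. Qed.

Lemma fejer_cos1 N y : cos y = 1 -> fejer N y >= N%:R ^+ 2.
Proof.
move=> cy; rewrite fejerE (eq_bigr (fun=> 1)) => [|n _]; last first.
  exact: cos_natmul1.
by rewrite sumr_const card_ord lerDl sqr_ge0.
Qed.

(** All angles ny with n < N lie within 1/2 of 0, so each cosine is at least 1/2, and the square of
    the cosine sum alone suffices. *)
Lemma fejer_near0 N y : N%:R * `|y| <= 2^-1 -> N%:R ^+ 2 / 4 <= fejer N y.
Proof.
move=> Ny; rewrite fejerE.
have : N%:R / 2 <= \sum_(n < N) cos (n%:R * y).
  have -> : N%:R / 2 = \sum_(n < N) 2^-1 :> R.
    by rewrite sumr_const card_ord mulr_natl.
  apply: ler_sum => n _.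
  have := cos_lipschitz 0 (n%:R * y).
  rewrite cos0 sub0r normrN normrM normr_nat.
  have : n%:R * `|y| <= N%:R * `|y| by rewrite ler_wpM2r// ler_nat ltnW.
  have := ler_norm (1 - cos (n%:R * y)); lra.
have N0 : 0 <= N%:R :> R by [].
have := sqr_ge0 (\sum_(n < N) sin (n%:R * y)); nra.
Qed.

End Trigonometry.

(** * Integration of bounded measurable functions against a probability *)

Section BoundedMeasurable.
Context {R : realType} (P : probability (measurableTypeR R) R).
Implicit Types f g : R -> R.

Definition bounded_measurable f :=
  measurable_fun [set: R] f /\ exists M, forall x, `|f x| <= M.

Lemma bounded_measurable_cst c : bounded_measurable (fun=> c).
Proof. by split; [exact: measurable_cst | exists `|c|]. Qed.

Lemma bounded_measurableD f g : bounded_measurable f ->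
  bounded_measurable g -> bounded_measurable (fun x : R => f x + g x).
Proof.
move=> [mf [M fM]] [mg [M' gM]]; split; first exact: measurable_funD.
by exists (M + M') => x; rewrite (le_trans (ler_normD _ _))// lerD.
Qed.

Lemma bounded_measurableM f g : bounded_measurable f ->
  bounded_measurable g -> bounded_measurable (fun x : R => f x * g x).
Proof.
move=> [mf [M fM]] [mg [M' gM]]; split; first exact: measurable_funM.
by exists (M * M') => x; rewrite normrM ler_pM.
Qed.

Lemma bounded_measurable_sum n (F : 'I_n -> R -> R) :
  (forall i, bounded_measurable (F i)) ->
  bounded_measurable (fun x : R => \sum_(i < n) F i x).
Proof.
move=> FM; rewrite (_ : (fun _ => _) = \sum_(i < n) F i); last first.
  by apply/funext => x; rewrite fct_sumE.
elim/big_ind : _ => // [|f g]; first exact: bounded_measurable_cst.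
exact: bounded_measurableD.
Qed.

Lemma bounded_measurable_integrable f : bounded_measurable f ->
  P.-integrable setT (EFin \o f).
Proof.
move=> [mf [M fM]]; apply: measurable_bounded_integrable => //.
  exact: le_lt_trans (probability_le1 P measurableT) (ltry 1).
exists M; split; first exact: num_real.
by move=> M' MM' x _; exact: le_trans (fM x) (ltW MM').
Qed.

Lemma bounded_measurable_trig (trig : R -> R) a b : continuous trig ->
  (forall x, `|trig x| <= 1) ->
  bounded_measurable (fun x : R => trig (a * (x - b))).
Proof.
move=> ctrig trig1; split; last by exists 1 => x.
apply: measurableT_comp; first exact: continuous_measurable_fun.
apply: measurable_funM => //; exact: measurable_funB.
Qed.

Lemma bounded_measurable_cos a b :
  bounded_measurable (fun x : R => cos (a * (x - b))).
Proof.
by apply: bounded_measurable_trig; [exact: continuous_cos|exact: cos_le_norm1].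
Qed.

Lemma bounded_measurable_sin a b :
  bounded_measurable (fun x : R => sin (a * (x - b))).
Proof.
by apply: bounded_measurable_trig; [exact: continuous_sin|exact: sin_le_norm1].
Qed.

Lemma bounded_measurable_fejer N x0 :
  bounded_measurable (fun x : R => fejer N (x - x0)).
Proof.
apply: bounded_measurable_sum => m; apply: bounded_measurableD.
  exact: bounded_measurable_cst.
under eq_fun do rewrite -mulr_natr.
apply: bounded_measurableM; last exact: bounded_measurable_cst.
by apply: bounded_measurable_sum => j; exact: bounded_measurable_cos.
Qed.

Lemma RintegralD_bounded f g : bounded_measurable f -> bounded_measurable g ->
  \int[P]_x (f x + g x) = \int[P]_x f x + \int[P]_x g x.
Proof.
by move=> ? ?; apply: RintegralD => //; exact: bounded_measurable_integrable.
Qed.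

Lemma RintegralZl_bounded c f : bounded_measurable f ->
  \int[P]_x (c * f x) = c * \int[P]_x f x.
Proof.
by move=> ?; apply: RintegralZl => //; exact: bounded_measurable_integrable.
Qed.

Lemma Rintegral_sum_bounded n (F : 'I_n -> R -> R) :
  (forall i, bounded_measurable (F i)) ->
  \int[P]_x (\sum_(i < n) F i x) = \sum_(i < n) \int[P]_x F i x.
Proof.
elim: n F => [|n IH] F FM.
  rewrite big_ord0; under eq_Rintegral do rewrite big_ord0.
  by rewrite Rintegral_cst// mul0r.
rewrite big_ord_recr/=; under eq_Rintegral do rewrite big_ord_recr/=.
rewrite RintegralD_bounded ?IH//.
exact: bounded_measurable_sum.
Qed.

Lemma markov_bounded f (A : set R) : bounded_measurable f -> measurable A ->
  (forall x, 0 <= f x) -> (forall x, A x -> 1 <= f x) ->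
  (P A <= (\int[P]_x f x)%:E)%E.
Proof.
move=> bf mA f0 f1.
rewrite /Rintegral fineK; last first.
  exact/integrable_fin_num/bounded_measurable_integrable.
rewrite -(setIT A) -(integral_indic P measurableT mA).
apply: ge0_le_integral => //.
- by apply/measurable_EFinP; exact: measurable_indic.
- by apply/measurable_EFinP; case: bf.
- move=> x _; rewrite lee_fin indicE; case: (boolP (x \in A)) => //= xA.
  exact/f1/set_mem.
Qed.

End BoundedMeasurable.

(** * Fourier coefficients at the integers and the Fejer kernel weighted by 1 - cos x *)

Section CharacteristicSequence.
Context {R : realType} (P : probability (measurableTypeR R) R).

Definition cos_coef t : R := \int[P]_x cos (t * x).
Definition sin_coef t : R := \int[P]_x sin (t * x).

Let bounded_measurable_cos0 t : bounded_measurable (fun x : R => cos (t * x)).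
Proof.
by have := bounded_measurable_cos t 0; under eq_fun do rewrite subr0.
Qed.

Let bounded_measurable_sin0 t : bounded_measurable (fun x : R => sin (t * x)).
Proof.
by have := bounded_measurable_sin t 0; under eq_fun do rewrite subr0.
Qed.

Lemma Rintegral_cst_probability (c : R) : \int[P]_x c = c.
Proof.
rewrite Rintegral_cst// (_ : _ [set: _]%classic = 1%E) ?mulr1//.
exact: (probability_setT P).
Qed.

Lemma cos_coef0 : cos_coef 0 = 1.
Proof.
rewrite /cos_coef; under eq_Rintegral do rewrite mul0r cos0.
exact: Rintegral_cst_probability.
Qed.

Lemma bounded_measurable_onem_cos : bounded_measurable (fun x : R => 1 - cos x).
Proof.
under eq_fun do rewrite -mulN1r.
apply: bounded_measurableD; first exact: bounded_measurable_cst.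
apply: bounded_measurableM; first exact: bounded_measurable_cst.
by have := bounded_measurable_cos0 1; under eq_fun do rewrite mul1r.
Qed.

(** Multiplication by 1 - cos x acts on the coefficients as minus half a second difference in t. *)
Lemma Rintegral_onem_cosM t x0 :
  \int[P]_x ((1 - cos x) * cos (t * (x - x0))) =
  cos (t * x0) * (cos_coef t - (cos_coef (t + 1) + cos_coef (t - 1)) / 2) +
  sin (t * x0) * (sin_coef t - (sin_coef (t + 1) + sin_coef (t - 1)) / 2).
Proof.
(* By the product formulas, [f cos] is (1 - cos x) cos(tx) and [f sin] is (1 - cos x) sin(tx). *)
pose f (g : R -> R) x :=
  g (t * x) + (- 2^-1 * g ((t + 1) * x) + - 2^-1 * g ((t - 1) * x)).
have bf g : (forall u, bounded_measurable (fun x : R => g (u * x))) ->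
    bounded_measurable (f g).
  move=> bg; do 2?[apply: bounded_measurableD => //];
  by apply: bounded_measurableM => //; exact: bounded_measurable_cst.
have intf g : (forall u, bounded_measurable (fun x : R => g (u * x))) ->
    \int[P]_x f g x = \int[P]_x g (t * x) -
      (\int[P]_x g ((t + 1) * x) + \int[P]_x g ((t - 1) * x)) / 2.
  move=> bg; have bZ c u : bounded_measurable (fun x : R => c * g (u * x)).
    by apply: bounded_measurableM => //; exact: bounded_measurable_cst.
  rewrite RintegralD_bounded//; last exact: bounded_measurableD.
  by rewrite RintegralD_bounded// !RintegralZl_bounded//; ring.
transitivity (\int[P]_x (cos (t * x0) * f cos x + sin (t * x0) * f sin x)).
  apply: eq_Rintegral => x _; rewrite /f.
  rewrite !(mulrBr, mulrDl, mulrBl, mul1r) !(cosB, sinB, cosD, sinD).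
  by rewrite mulN1r cosN sinN; field.
etransitivity; first apply: RintegralD_bounded.
- by apply: bounded_measurableM; [exact: bounded_measurable_cst|exact: bf].
- by apply: bounded_measurableM; [exact: bounded_measurable_cst|exact: bf].
by rewrite !RintegralZl_bounded ?intf//; exact: bf.
Qed.

(** The size of phi(n) - phi(n+1) in the l^1 norm of the plane; bounded partial sums mean that
    (phi(n)) has bounded variation. *)
Definition coef_jump n : R :=
  `|cos_coef n%:R - cos_coef n.+1%:R| + `|sin_coef n%:R - sin_coef n.+1%:R|.

Lemma coef_jump_ge0 n : 0 <= coef_jump n.
Proof. by rewrite addr_ge0. Qed.

(** The second difference centred at n + 1 is a difference of two consecutive first differences, and
    the trigonometric factors in x0 are at most 1 in modulus; hence the bound is uniform in x0. *)
Lemma Rintegral_onem_cosM_le n x0 :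
  \int[P]_x ((1 - cos x) * cos (n.+1%:R * (x - x0))) *+ 2 <=
  coef_jump n.+1 + coef_jump n.
Proof.
have e : n.+1%:R - 1 = n%:R :> R by rewrite -natr1 addrK.
rewrite Rintegral_onem_cosM natr1 e /coef_jump.
set a := _ * x0; set c0 := cos_coef n%:R; set s0 := sin_coef n%:R.
set c1 := cos_coef n.+1%:R; set s1 := sin_coef n.+1%:R.
set c2 := cos_coef n.+2%:R; set s2 := sin_coef n.+2%:R.
have le (u v w k : R) : `|k| <= 1 ->
    k * (v - (w + u) / 2) <= (`|v - w| + `|u - v|) / 2.
  move=> k1; apply: le_trans (ler_norm _) _; rewrite normrM.
  apply: (@le_trans _ _ (`|(v - w) / 2 - (u - v) / 2|)).
    by rewrite (_ : (v - w) / 2 - _ = v - (w + u) / 2) ?ler_piMl//; field.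
  apply: le_trans (ler_normB _ _) _.
  by rewrite !normrM [`|2^-1|]ger0_norm// -mulrDl.
have := le c0 c1 c2 _ (cos_le_norm1 a); have := le s0 s1 s2 _ (sin_le_norm1 a).
lra.
Qed.

Lemma Rintegral_onem_cos_fejer_le K N x0 :
  (forall n, \sum_(i < n) coef_jump i <= K) ->
  \int[P]_x ((1 - cos x) * fejer N (x - x0)) <= N%:R * (3 * K).
Proof.
move=> leK.
have bo := bounded_measurable_onem_cos.
pose F (j : nat) x : R := (1 - cos x) * cos (j.+1%:R * (x - x0)).
have bF j : bounded_measurable (F j).
  by apply: bounded_measurableM => //; exact: bounded_measurable_cos.
have bS m : bounded_measurable (fun x : R => 2 * \sum_(j < m) F j x).
  apply: bounded_measurableM; first exact: bounded_measurable_cst.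
  exact: bounded_measurable_sum.
have -> : \int[P]_x ((1 - cos x) * fejer N (x - x0)) =
    \sum_(m < N) \int[P]_x ((1 - cos x) + 2 * \sum_(j < m) F j x).
  rewrite -Rintegral_sum_bounded => [|m]; last exact: bounded_measurableD.
  apply: eq_Rintegral => x _; rewrite mulr_sumr; apply: eq_bigr => m _.
  by rewrite mulrDr mulr1 mulr_natl -mulr_sumr mulrnAr.
have -> : N%:R * (3 * K) = \sum_(m < N) (3 * K).
  by rewrite sumr_const card_ord mulr_natl.
(* For each m there are three pieces, each at most K: the constant term, and the sums of [coef_jump]
   over j < m with and without a shift of the index. *)
apply: ler_sum => m _.
rewrite RintegralD_bounded// RintegralZl_bounded; last first.
  exact: bounded_measurable_sum.
rewrite Rintegral_sum_bounded// mulr_natl -sumrMnl.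
have : \int[P]_x (1 - cos x) <= coef_jump 0.
  rewrite (_ : \int[P]_x _ = cos_coef 0 - cos_coef 1).
    by rewrite (le_trans (ler_norm _))// lerDl.
  rewrite cos_coef0 -[X in X - _]Rintegral_cst_probability /cos_coef.
  rewrite -RintegralB//.
  - by apply: eq_Rintegral => x _; rewrite mul1r.
  - exact/bounded_measurable_integrable/bounded_measurable_cst.
  - exact/bounded_measurable_integrable.
have : \sum_(j < m) (\int[P]_x F j x) *+ 2 <=
    \sum_(j < m) coef_jump j.+1 + \sum_(j < m) coef_jump j.
  rewrite -big_split; apply: ler_sum => j _.
  exact: Rintegral_onem_cosM_le.
have := leK m; have := leK 1; rewrite big_ord1/=.
have : coef_jump 0 + \sum_(j < m) coef_jump j.+1 <= K.
  by have := leK m.+1; rewrite big_ord_recl.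
have := coef_jump_ge0 0; lra.
Qed.

End CharacteristicSequence.

(** * From bounded variation of the coefficients to absolute continuity *)

Section AbsoluteContinuity.
Context {R : realType} (P : probability (measurableTypeR R) R).
Local Open Scope classical_set_scope.

Definition off_period (d : R) : set R := [set x | d <= 1 - cos x].

Lemma measurable_off_period d : measurable (off_period d).
Proof.
have [m _] := bounded_measurable_onem_cos (R := R).
rewrite (_ : off_period d = (fun x => 1 - cos x) @^-1` `[d, +oo[).
  by rewrite -[X in measurable X]setTI; exact: m.
by apply/seteqP; split => x /=; rewrite in_itv/= andbT.
Qed.

(** With N close to 1/(b - a), the kernel centred at the midpoint is at least N^2/4 on the interval
    and the weight is at least d, whereas the weighted expectation is at most 3NK. The quotient
    12K/(dN) is of order b - a. *)
Lemma probability_itv_off_period_le K d a b :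
  (forall n, \sum_(i < n) coef_jump P i <= K) -> 0 < d -> a < b ->
  (P (`]a, b[ `&` off_period d) <= ((24 * K / d + 1) * (b - a))%:E)%E.
Proof.
move=> leK d0 ab.
have K0 : 0 <= K by have := leK 0; rewrite big_ord0.
have D0 : 0 <= 24 * K / d by rewrite divr_ge0 ?mulr_ge0// ltW.
have mA : measurable (`]a, b[ `&` off_period d).
  by apply: measurableI; [exact: measurable_itv|exact: measurable_off_period].
(* Long intervals are covered by the summand 1 of the constant; otherwise N below is at least 1. *)
have [ba1|ba1] := leP 1 (b - a).
  apply: le_trans (probability_le1 P mA) _; rewrite lee_fin.
  by rewrite (le_trans ba1)// ler_peMl ?lerDr// subr_ge0 ltW.
pose l := b - a; have l0 : 0 < l by rewrite subr_gt0.
(* N l <= 1 keeps the interval within 1/(2N) of its midpoint, as [fejer_near0] requires; (N + 1) l >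
   1 gives 1/N <= 2l. *)
pose N := Num.truncn l^-1.
have [N1 N2] : N%:R <= l^-1 /\ l^-1 < N.+1%:R.
  by apply/andP/truncn_itv; rewrite invr_ge0 ltW.
have N0 : (0 < N)%N by rewrite truncn_gt0 invf_ge1// ltW.
have N0' : 0 < N%:R :> R by rewrite ltr0n.
have N1' : 1 <= N%:R :> R by rewrite ler1n.
pose x0 := (a + b) / 2.
have bo := bounded_measurable_onem_cos (R := R).
have bfe := bounded_measurable_fejer N x0.
pose c := (d * (N%:R ^+ 2 / 4))^-1.
have c0 : 0 < c by rewrite invr_gt0 mulr_gt0// divr_gt0// exprn_gt0.
have bw : bounded_measurable (fun x : R => (1 - cos x) * fejer N (x - x0)).
  exact: bounded_measurableM.
have bf :
    bounded_measurable (fun x : R => c * ((1 - cos x) * fejer N (x - x0))).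
  by apply: bounded_measurableM => //; exact: bounded_measurable_cst.
apply: le_trans (markov_bounded P _ _ bf mA _ _) _.
- move=> x; apply: mulr_ge0; first exact: ltW.
  by apply: mulr_ge0; [rewrite subr_ge0 cos_le1|exact: fejer_ge0].
- move=> x [/=]; rewrite in_itv/= /off_period/= => /andP[ax xb] dx.
  rewrite -[leLHS](mulVf (_ : d * (N%:R ^+ 2 / 4) != 0)); last first.
    by rewrite -invr_eq0 gt_eqF.
  rewrite ler_wpM2l ?(ltW c0)//.
  apply: ler_pM => //; first exact: ltW.
  apply: fejer_near0.
  have xl : `|x - x0| <= l / 2 by rewrite ler_norml /x0 /l; lra.
  apply: le_trans (ler_wpM2l (ltW N0') xl) _.
  have : N%:R * l <= 1 by rewrite -ler_pdivlMr// mul1r.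
  lra.
rewrite lee_fin RintegralZl_bounded//.
apply: le_trans (ler_wpM2l (ltW c0) _) _.
  exact: (Rintegral_onem_cos_fejer_le P K N x0 leK).
have -> : c * (N%:R * (3 * K)) = 12 * K / d * N%:R^-1.
  by rewrite /c; field; rewrite !gt_eqF.
have Nl : N%:R^-1 <= 2 * l.
  have : 1 < N.+1%:R * l by rewrite -ltr_pdivrMr// mul1r.
  rewrite -natr1 -[X in X <= _]mul1r ler_pdivrMr// => h; nra.
apply: (@le_trans _ _ (12 * K / d * (2 * l))).
  by rewrite ler_wpM2l// divr_ge0 ?mulr_ge0// ltW.
have -> : (24 * K / d + 1) * (b - a) = 12 * K / d * (2 * l) + l.
  by rewrite /l; ring.
by rewrite lerDl ltW.
Qed.

(** A null set is covered by open intervals of arbitrarily small total length, and the bound on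
    intervals is summed over such a cover. *)
Lemma probability_null_of_itv_le (A B : set R) D :
  0 <= D -> measurable A -> measurable B ->
  (forall a b, a < b -> (P (`]a, b[ `&` B) <= (D * (b - a))%:E)%E) ->
  (@lebesgue_measure R A = 0)%E -> P (A `&` B) = 0%E.
Proof.
move=> D0 mA mB PD A0.
suff P0 e : 0 < e -> (P (A `&` B) <= (D * e)%:E)%E.
  apply/eqP; rewrite eq_le measure_ge0 andbT; apply/lee_addgt0Pr => e e0.
  (* Dividing by D + 1 instead of D allows D = 0. *)
  rewrite add0e (le_trans (P0 (e / (D + 1)) _))//.
    by rewrite divr_gt0// ltr_wpDl.
  rewrite lee_fin mulrA ler_pdivrMr ?ltr_wpDl// mulrC ler_wpM2l ?(ltW e0)//.
  by rewrite lerDl.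
move=> e0.
(* Lebesgue measure is the outer measure of the interval length, hence an infimum over covers by
   open intervals. *)
have [F [AFi AF] Fe] : exists2 I_, open_itv_cover A I_ &
    (\sum_(0 <= k <oo) (wlength idfun) (I_ k) <= e%:E)%E.
  have : ((wlength idfun)^* A)%mu = 0%E := A0.
  rewrite outer_measure_open_itv_cover => A0'.
  have := @lb_ereal_inf_adherent R
    [set (\sum_(0 <= k <oo) (wlength idfun) (F k))%E |
      F in open_itv_cover A] e e0.
  rewrite A0' => /(_ isT)[_/= [F]] AF <- Fe.
  by exists F => //; rewrite ltW// -[e%:E]add0e.
have mF k : measurable (F k).
  by have [ab ->] := AFi k; exact: measurable_itv.
apply: (@le_trans _ _ (\sum_(0 <= k <oo) P (F k `&` B))%E).
  apply: measure_sigma_subadditive.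
  - by move=> n; apply: measurableI; [exact: mF|exact: mB].
  - exact: measurableI.
  - by move=> x [/AF[k _ Fkx] Bx]; exists k.
apply: (@le_trans _ _ (\sum_(0 <= k <oo) (D%:E * (wlength idfun) (F k)))%E).
  apply: lee_nneseries => // k _.
  have [[a b] ->]/= := AFi k; rewrite wlength_itv/= lte_fin.
  have [ab|ba] := ltP a b; first by rewrite -EFinB -EFinM PD.
  by rewrite set_itv_ge ?bnd_simp -?leNgt// set0I measure0 mule0.
by rewrite nneseriesZl// EFinM lee_wpmul2l.
Qed.

Lemma measurable_cos_eq1 : measurable [set x : R | cos x = 1].
Proof.
have [m _] := bounded_measurable_cos (R := R) 1 0.
rewrite (_ : [set x | cos x = 1] = (fun x => cos (1 * (x - 0))) @^-1` [set 1]).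
  by rewrite -[X in measurable X]setTI; exact: m.
by apply/seteqP; split => x /=; rewrite mul1r subr0.
Qed.

(** Divided by N^2, the kernel is nonnegative and at least 1 on 2 pi Z. Its expectation is at most
    1/N plus twice a Cesaro mean of the moduli of the cosine coefficients, and this tends to 0. *)
Lemma probability_cos_eq1 : (fun n => cos_coef P n%:R) @ \oo --> (0 : R) ->
  P [set x | cos x = 1] = 0%E.
Proof.
move=> C0.
have mA := measurable_cos_eq1.
(* The shift matches the frequencies j + 1 of the kernel. *)
pose u n := `|cos_coef P n.+1%:R|.
have u0 : u @ \oo --> (0 : R).
  rewrite -(@normr0 _ R); apply: cvg_norm.
  by have := C0; rewrite -cvg_shiftS.
suff pn n : (P [set x : R | cos x = 1%R] <=
    (n.+1%:R^-1 + 2 * arithmetic_mean u n)%:E)%E.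
  have pfin := fin_num_measure P _ mA.
  have le0 : fine (P [set x : R | cos x = 1]) <= 0.
    have cv : (fun n => n.+1%:R^-1 + 2 * arithmetic_mean u n) @ \oo --> (0 : R).
      rewrite -[0 in X in _ --> X]addr0; apply: cvgD; first exact: cvg_harmonic.
      by rewrite -(mulr0 2); apply: cvgMr; exact: cesaro.
    rewrite -(cvg_lim (@Rhausdorff R) cv); apply: limr_ge.
      by apply/cvg_ex; exists 0.
    by apply: nearW => n; rewrite -lee_fin fineK.
  by apply/eqP; rewrite eq_le measure_ge0 andbT -(fineK pfin) lee_fin.
pose N := n.+1; have N0 : 0 < N%:R :> R by rewrite ltr0n.
have bfe : bounded_measurable (fun x : R => fejer N (x - 0)).
  exact: bounded_measurable_fejer.
have bf : bounded_measurable (fun x : R => (N%:R ^+ 2)^-1 * fejer N (x - 0)).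
  by apply: bounded_measurableM => //; exact: bounded_measurable_cst.
apply: le_trans (markov_bounded P _ _ bf mA _ _) _.
- by move=> x; rewrite mulr_ge0 ?invr_ge0 ?sqr_ge0// fejer_ge0.
- move=> x /= cx; rewrite mulrC ler_pdivlMr ?exprn_gt0// mul1r subr0.
  exact: fejer_cos1.
rewrite lee_fin RintegralZl_bounded// mulrC ler_pdivrMr ?exprn_gt0//.
have -> : (n.+1%:R^-1 + 2 * arithmetic_mean u n) * N%:R ^+ 2 =
    \sum_(m < N) (1 + 2 * \sum_(j < N) u j).
  rewrite sumr_const card_ord -mulr_natr /arithmetic_mean/= /series/= big_mkord.
  by rewrite -/N; field; rewrite gt_eqF.
rewrite Rintegral_sum_bounded => [|m]; last first.
  apply: bounded_measurableD; first exact: bounded_measurable_cst.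
  under eq_fun do rewrite -mulr_natr.
  apply: bounded_measurableM; last exact: bounded_measurable_cst.
  by apply: bounded_measurable_sum => j; exact: bounded_measurable_cos.
apply: ler_sum => m _.
under eq_Rintegral do rewrite -mulr_natl.
rewrite RintegralD_bounded; first last.
- apply: bounded_measurableM; first exact: bounded_measurable_cst.
  by apply: bounded_measurable_sum => j; exact: bounded_measurable_cos.
- exact: bounded_measurable_cst.
rewrite Rintegral_cst_probability lerD2l RintegralZl_bounded; last first.
  by apply: bounded_measurable_sum => j; exact: bounded_measurable_cos.
rewrite ler_wpM2l// Rintegral_sum_bounded => [|j]; last first.
  exact: bounded_measurable_cos.
(* Once the coefficients are replaced by their moduli, the sum over j < m may be extended to j <
   N. *)
apply: (@le_trans _ _ (\sum_(j < m) u j)).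
  apply: ler_sum => j _; apply: le_trans (ler_norm _) _.
  by under eq_Rintegral do rewrite subr0.
rewrite (big_ord_widen_cond N xpredT u (ltnW (ltn_ord m))).
rewrite [leRHS](bigID (fun j : 'I_N => (j < m)%N))/= lerDl.
by apply: sumr_ge0 => j _; exact: normr_ge0.
Qed.

(** The complement of 2 pi Z is a countable union of sets where 1 - cos x is bounded below, and the
    interval estimate handles each of them; 2 pi Z itself has probability 0. *)
Lemma null_dominates_of_coef_jump K :
  (forall n, \sum_(i < n) coef_jump P i <= K) ->
  (fun n => cos_coef P n%:R) @ \oo --> (0 : R) ->
  P `<< (@lebesgue_measure R).
Proof.
move=> leK C0; apply/null_content_dominatesP => A mA A0.
apply/(negligibleP P mA).
have : A `<=` [set x | cos x = 1] `|`
    \bigcup_n (A `&` off_period n.+1%:R^-1).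
  move=> x Ax /=; have [->|cx] := eqVneq (cos x) 1; [by left|right].
  have cx0 : 0 < 1 - cos x by rewrite subr_gt0 lt_neqAle cx cos_le1.
  (* This n satisfies n + 1 > 1/(1 - cos x). *)
  exists (Num.truncn (1 - cos x)^-1) => //; split => //; rewrite /off_period/=.
  rewrite -[leRHS]invrK lef_pV2 ?posrE ?invr_gt0//.
  by rewrite ltW// truncnS_gt.
move/negligibleS; apply; apply: negligibleU.
  exact/(negligibleP P measurable_cos_eq1)/probability_cos_eq1.
apply: negligible_bigcup => n; apply/negligibleP.
  by apply: measurableI => //; exact: measurable_off_period.
have n0 : 0 < n.+1%:R^-1 :> R by rewrite invr_gt0.
apply: (@probability_null_of_itv_le _ _ (24 * K / n.+1%:R^-1 + 1)) => //.
- rewrite addr_ge0// divr_ge0 ?(ltW n0)// mulr_ge0//.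
  by have := leK 0; rewrite big_ord0.
- exact: measurable_off_period.
- by move=> a b ab; exact: probability_itv_off_period_le.
Qed.

(** The sign [e] lets an increasing [phi] describe a phase that is monotone in either direction. *)
Lemma null_dominates_of_monotone_polar (m phi : nat -> R) (e M : R) :
  `|e| = 1 ->
  (forall n, 0 <= m n <= 1) -> (forall n, m n.+1 <= m n) ->
  m @ \oo --> (0 : R) ->
  (forall n, 0 <= phi n <= M) -> (forall n, phi n <= phi n.+1) ->
  (forall n, cos_coef P n%:R = m n * cos (e * phi n)) ->
  (forall n, sin_coef P n%:R = - (m n * sin (e * phi n))) ->
  P `<< (@lebesgue_measure R).
Proof.
move=> e1 m01 mdecr m0 phi0M phiincr CE SE.
apply: (null_dominates_of_coef_jump (2 * (1 + M))); last first.
  have -> : (fun n => cos_coef P n%:R) = (fun n => m n * cos (e * phi n)).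
    exact/funext.
  have Nm0 : (fun n => - m n) @ \oo --> (0 : R) by rewrite -oppr0; exact: cvgN.
  apply: squeeze_cvgr Nm0 m0; apply: nearW => n.
  have /andP[mn0 _] := m01 n.
  by rewrite -ler_norml normrM (ger0_norm mn0) ler_piMr// cos_le_norm1.
(* [V] decreases, and each step of [V] bounds the jump of the cosine part and that of the sine part,
   whence the factor 2. Its total drop is at most 1 + M. *)
move=> n; pose V k := m k - phi k.
apply: (@le_trans _ _ (2 * (V 0 - V n))).
  rewrite -opprB -(telescope_sumr V (leq0n n)) -sumrN big_mkord mulr_sumr.
  apply: ler_sum => i _.
  have /andP[mi0 mi1] := m01 i.+1.
  have jump (g : R -> R) : (forall x, `|g x| <= 1) ->
      (forall x y, `|g x - g y| <= `|x - y|) ->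
      `|m i * g (e * phi i) - m i.+1 * g (e * phi i.+1)| <= V i - V i.+1.
    move=> g1 gL.
    apply: le_trans (norm_scaledB_le _ _ _ _ _ g1 gL mi0 (mdecr i) mi1) _.
    rewrite -mulrBr normrM e1 mul1r distrC ger0_norm ?subr_ge0// /V.
    lra.
  have jc := jump _ cos_le_norm1 cos_lipschitz.
  have js := jump _ sin_le_norm1 sin_lipschitz.
  rewrite /coef_jump !CE !SE -opprD normrN opprB.
  lra.
rewrite ler_pM2l//.
have /andP[_ h1] := m01 0; have /andP[h2 _] := m01 n.
have /andP[h3 _] := phi0M 0; have /andP[_ h4] := phi0M n.
rewrite /V; lra.
Qed.

End AbsoluteContinuity.

(** * Modulus and angle along the ray 1 + r(c + is) *)

Section LinnikSequence.
Context {R : realType}.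
Implicit Types (r c s nu : R).

Lemma acos_le (x y : R) : -1 <= x -> x <= y -> y <= 1 -> acos y <= acos x.
Proof.
move=> x1 xy y1; rewrite leNgt; apply/negP => axy.
have xb : -1 <= x <= 1 by rewrite x1 (le_trans xy).
have yb : -1 <= y <= 1 by rewrite y1 (le_trans x1).
have [|t] := @MVT_segment _ cos (fun z => - sin z) _ _ (ltW axy)
  (fun z _ => is_derive_cos z).
  exact/continuous_subspaceT/continuous_cos.
rewrite in_itv/= => /andP[xt ty].
rewrite !acosK ?in_itv// => e.
have st : 0 <= sin t.
  by rewrite sin_ge0_pi// (le_trans (acos_ge0 xb))//= (le_trans ty)// acos_lepi.
have xe : x = y.
  apply/eqP; rewrite eq_le xy -subr_le0 e mulNr oppr_le0 mulr_ge0//.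
  by rewrite subr_ge0 ltW.
by rewrite xe ltxx in axy.
Qed.

(** The modulus of 1 + r(c + is) and, next, the absolute value of its principal argument: the
    arccosine forgets the sign of s. *)
Definition ray_norm c s r : R := Num.sqrt ((1 + r * c) ^+ 2 + (r * s) ^+ 2).
Definition ray_angle c s r : R := acos ((1 + r * c) / ray_norm c s r).

Lemma ray_norm_ge1 c s r : 0 <= c -> 0 <= r -> 1 <= ray_norm c s r.
Proof.
move=> c0 r0; rewrite -[leLHS]sqrtr1 ler_wsqrtr//.
have := mulr_ge0 r0 c0; have := sqr_ge0 (r * s); nra.
Qed.

Lemma ray_norm_ge c s r : 0 <= c -> c ^+ 2 + s ^+ 2 = 1 -> 0 <= r ->
  r <= ray_norm c s r.
Proof.
move=> c0 cs r0; rewrite -[leLHS](ger0_norm r0) -sqrtr_sqr ler_wsqrtr//.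
have -> : (1 + r * c) ^+ 2 + (r * s) ^+ 2 =
    1 + 2 * (r * c) + r ^+ 2 * (c ^+ 2 + s ^+ 2) by ring.
by rewrite cs; have := mulr_ge0 r0 c0; lra.
Qed.

Lemma ray_norm_le c s r r' : 0 <= c -> 0 <= r -> r <= r' ->
  ray_norm c s r <= ray_norm c s r'.
Proof.
move=> c0 r0 rr'; rewrite ler_wsqrtr//.
have rc := mulr_ge0 r0 c0; have rc' : r * c <= r' * c by rewrite ler_wpM2r.
have : r ^+ 2 * s ^+ 2 <= r' ^+ 2 * s ^+ 2 by rewrite ler_wpM2r ?sqr_ge0//; nra.
rewrite !exprMn; nra.
Qed.

Lemma ray_cos_ge0_le1 c s r : 0 <= c -> 0 <= r ->
  0 <= (1 + r * c) / ray_norm c s r <= 1.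
Proof.
move=> c0 r0; have rn := ray_norm_ge1 c s r c0 r0.
have rc : 0 <= 1 + r * c by rewrite addr_ge0// mulr_ge0.
have rn0 : 0 < ray_norm c s r by exact: lt_le_trans rn.
rewrite divr_ge0 ?(ltW rn0)//= ler_pdivrMr// mul1r.
by rewrite -[leLHS]ger0_norm// -sqrtr_sqr ler_wsqrtr// lerDl sqr_ge0.
Qed.

Lemma ray_angle_ge0_lepi c s r : 0 <= c -> 0 <= r -> 0 <= ray_angle c s r <= pi.
Proof.
move=> c0 r0; have /andP[h0 h1] := ray_cos_ge0_le1 c s r c0 r0.
have h : -1 <= (1 + r * c) / ray_norm c s r <= 1.
  by rewrite h1 andbT (le_trans _ h0).
by rewrite acos_ge0// acos_lepi.
Qed.

(** The cosine of the angle decreases in r. Both cosines are nonnegative because c >= 0, so they may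
    be compared through their squares, where the difference factors explicitly. *)
Lemma ray_angle_le c s r r' : 0 <= c -> 0 <= r -> r <= r' ->
  ray_angle c s r <= ray_angle c s r'.
Proof.
move=> c0 r0 rr'; have r'0 := le_trans r0 rr'.
have /andP[h0 _] := ray_cos_ge0_le1 c s r' c0 r'0.
have /andP[_ h1] := ray_cos_ge0_le1 c s r c0 r0.
apply: acos_le => //; first by rewrite (le_trans _ h0).
have n0 := lt_le_trans ltr01 (ray_norm_ge1 c s r c0 r0).
have n0' := lt_le_trans ltr01 (ray_norm_ge1 c s r' c0 r'0).
rewrite ler_pdivrMr// mulrAC ler_pdivlMr//.
have rc0 := mulr_ge0 r0 c0; have rc0' := mulr_ge0 r'0 c0.
have l0 : 0 <= (1 + r' * c) * ray_norm c s r.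
  by rewrite mulr_ge0 ?addr_ge0// ltW.
have l0' : 0 <= (1 + r * c) * ray_norm c s r'.
  by rewrite mulr_ge0 ?addr_ge0// ltW.
rewrite -(ler_pXn2r (isT : (0 < 2)%N)) ?nnegrE//.
rewrite !exprMn !sqr_sqrtr ?addr_ge0 ?sqr_ge0// -subr_ge0.
have -> : (1 + r * c) ^+ 2 * ((1 + r' * c) ^+ 2 + (r' * s) ^+ 2) -
    (1 + r' * c) ^+ 2 * ((1 + r * c) ^+ 2 + (r * s) ^+ 2) =
    s ^+ 2 * ((r' - r) * (r + r' + 2 * r * r' * c)) by ring.
rewrite mulr_ge0 ?sqr_ge0// mulr_ge0 ?subr_ge0//.
by rewrite !addr_ge0// !mulr_ge0.
Qed.

End LinnikSequence.

(** * The Linnik characteristic function in polar form *)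

Section Linnik.
Context {R : realType}.
Local Open Scope classical_set_scope.
Implicit Types (u : R).
Variables lambda alpha theta nu : R.
Hypotheses (lambda0 : 0 < lambda) (alpha0 : 0 < alpha) (nu0 : 0 < nu).
Hypothesis cos_theta0 : 0 <= cos theta.

Let radius u : R := lambda * u `^ alpha.
Let modulus u : R := (ray_norm (cos theta) (- sin theta) (radius u) `^ nu)^-1.
Let phase u : R := nu * ray_angle (cos theta) (- sin theta) (radius u).

(** For u >= 0 the base stays on one ray, so the sign of its argument can be chosen independently of
    u; the inverse conjugates the phase, hence the minus sign before the sine. *)
Lemma linnik_cfE : exists2 e : R, `|e| = 1 & forall u, 0 <= u ->
  linnik_cf lambda alpha theta nu u =
  (modulus u * cos (e * phase u) +i* (- (modulus u * sin (e * phase u))))%C.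
Proof.
exists (if 0 <= - sin theta then 1 else - 1).
  by case: ifP => _; rewrite ?normrN normr1.
move=> u u0; have r0 : 0 <= radius u by rewrite mulr_ge0 ?powR_ge0// ltW.
have n1 := ray_norm_ge1 (cos theta) (- sin theta) (radius u) cos_theta0 r0.
have wE : (1 + (lambda * `|u| `^ alpha)%:C * expi (- (theta * Num.sg u)) =
    (1 + radius u * cos theta) +i* (radius u * - sin theta))%C.
  rewrite ger0_norm// -/(radius u) /expi cosN sinN.
  (* At u = 0 the sign is 0 instead of 1, which is harmless since the radius vanishes there. *)
  move: u0; rewrite le_eqVlt => /predU1P[<-|u0].
    by rewrite /radius powR0 ?gt_eqF// mulr0 !mul0r !addr0.
  by rewrite gtr0_sg// mulr1; simpc.
rewrite /linnik_cf wE /principal_pow /=.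
rewrite -/(ray_norm (cos theta) (- sin theta) (radius u)).
have -> : principal_arg
      ((1 + radius u * cos theta) +i* (radius u * - sin theta))%C =
    (if 0 <= - sin theta then 1 else - 1) *
    ray_angle (cos theta) (- sin theta) (radius u).
  rewrite /principal_arg/=.
  rewrite -/(ray_norm (cos theta) (- sin theta) (radius u)).
  rewrite -/(ray_angle (cos theta) (- sin theta) (radius u)).
  have [s0|s0] := leP 0 (- sin theta).
    by rewrite mulr_ge0// mul1r.
  (* At radius 0 the imaginary part is 0 and the test takes the other branch, but the angle is 0. *)
  move: r0; rewrite le_eqVlt => /predU1P[<-|r0].
    rewrite mul0r lexx /ray_angle /ray_norm !mul0r addr0.
    by rewrite expr1n expr0n addr0 sqrtr1 divr1 acos1 mulr0.
  by rewrite leNgt pmulr_rlt0// s0 mulN1r.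
set t := nu * _.
have -> : (if 0 <= - sin theta then 1 else - 1) * phase u = t.
  by rewrite /t /phase mulrCA.
rewrite /expi /modulus; set a := _ `^ nu.
have a0 : a != 0 by rewrite powR_eq0 gt_eqF ?(lt_le_trans ltr01)//.
have -> : (a%:C * (cos t +i* sin t))%C = (a * cos t +i* (a * sin t))%C by simpc.
apply: mulr1_eq; simpc; apply/eqP; rewrite eq_complex/=.
apply/andP; split; apply/eqP.
  by rewrite -(cos2Dsin2 t); field.
by ring.
Qed.

Let radius_le u v : 0 <= u -> u <= v -> radius u <= radius v.
Proof.
move=> u0 uv; apply: (ler_wpM2l (ltW lambda0)).
by apply: (ge0_ler_powR (ltW alpha0)); rewrite ?nnegrE// (le_trans u0).
Qed.

Let radius_ge0 u : 0 <= radius u.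
Proof. exact: mulr_ge0 (ltW lambda0) (powR_ge0 _ _). Qed.

Let modulus_ge0_le1 u : 0 <= modulus u <= 1.
Proof.
have n1 := ray_norm_ge1 (cos theta) (- sin theta) _ cos_theta0 (radius_ge0 u).
rewrite invr_ge0 powR_ge0/= invf_le1; last first.
  by apply: powR_gt0; exact: lt_le_trans n1.
have <- : 1 `^ nu = 1 :> R by rewrite powR1.
by apply: (ge0_ler_powR (ltW nu0)) => //; rewrite nnegrE (le_trans ler01).
Qed.

Let modulus_le u v : 0 <= u -> u <= v -> modulus v <= modulus u.
Proof.
move=> u0 uv.
have n1 w := ray_norm_ge1 (cos theta) (- sin theta) _ cos_theta0 (radius_ge0 w).
have n0 w := lt_le_trans ltr01 (n1 w).
rewrite /modulus lef_pV2 ?posrE; [|exact: powR_gt0..].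
apply: (ge0_ler_powR (ltW nu0)); rewrite ?nnegrE; [exact: ltW..|].
by apply: ray_norm_le => //; exact: radius_le.
Qed.

Let phase_le u v : 0 <= u -> u <= v -> phase u <= phase v.
Proof.
move=> u0 uv; apply: (ler_wpM2l (ltW nu0)); apply: ray_angle_le => //.
exact: radius_le.
Qed.

Let phase_ge0_le u : 0 <= phase u <= nu * pi.
Proof.
have /andP[h0 h1] := ray_angle_ge0_lepi (cos theta) (- sin theta) _
  cos_theta0 (radius_ge0 u).
by rewrite mulr_ge0 ?(ltW nu0)//= ler_wpM2l// ltW.
Qed.

Let modulus_cvg0 : (fun n => modulus n%:R) @ \oo --> (0 : R).
Proof.
rewrite -(@cvg_shiftS).
(* Since |1 + r e^{-i theta}| >= r, the modulus at u = n + 1 is at most (lambda u^alpha)^{-nu},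
   which is [f n]; the shift avoids u = 0. *)
pose f n := (lambda `^ nu)^-1 * n.+1%:R^-1 `^ (alpha * nu).
have f0 : f @ \oo --> (0 : R).
  rewrite -(mulr0 (lambda `^ nu)^-1); apply: cvgMr.
  have := @powR_cvg0 R _ (mulr_gt0 alpha0 nu0).
  move/cvg_at_rightP; apply; split; last exact: cvg_harmonic.
  by move=> n; rewrite invr_gt0.
apply: squeeze_cvgr f0; last exact: cvg_cst.
apply: nearW => n; have /andP[-> _]/= := modulus_ge0_le1 n.+1%:R.
have n0 : 0 < n.+1%:R `^ alpha :> R by rewrite powR_gt0.
have -> : f n = (radius n.+1%:R `^ nu)^-1.
  rewrite /f /radius powRM ?(ltW n0) ?(ltW lambda0)// invfM; congr (_ * _).
  by rewrite -powR_inv1// -powRrM mulN1r powRN -powRrM.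
have rn0 : 0 < radius n.+1%:R by rewrite mulr_gt0.
rewrite lef_pV2 ?posrE ?powR_gt0//; last first.
  exact: lt_le_trans (ray_norm_ge1 _ _ _ cos_theta0 (radius_ge0 _)).
have rn : radius n.+1%:R <= ray_norm (cos theta) (- sin theta) (radius n.+1%:R).
  by rewrite ray_norm_ge// sqrrN cos2Dsin2.
by rewrite ge0_ler_powR ?nnegrE ?(ltW nu0) ?(ltW rn0)// (le_trans (ltW rn0)).
Qed.

Lemma linnik_null_dominates (P : probability (measurableTypeR R) R) :
  is_generalized_linnik lambda alpha theta nu P -> P `<< (@lebesgue_measure R).
Proof.
move=> PL; have [e e1 cfE] := linnik_cfE.
have [CE SE] :
    (forall n, cos_coef P n%:R = modulus n%:R * cos (e * phase n%:R)) /\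
    (forall n, sin_coef P n%:R = - (modulus n%:R * sin (e * phase n%:R))).
  by split=> n; have := PL n%:R; rewrite cfE// => -[].
have le_natS n : n%:R <= n.+1%:R :> R by rewrite ler_nat.
exact: (@null_dominates_of_monotone_polar _ P (fun n => modulus n%:R)
  (fun n => phase n%:R) e (nu * pi) e1 (fun=> modulus_ge0_le1 _)
  (fun n => modulus_le _ _ (ler0n _ _) (le_natS n)) modulus_cvg0
  (fun=> phase_ge0_le _) (fun n => phase_le _ _ (ler0n _ _) (le_natS n)) CE SE).
Qed.

End Linnik.

Theorem theorem2p5 (R : realType) (k : nat) (lambda alpha theta : R)
    (P : probability (measurableTypeR R) R) :
  (1 <= k)%N ->
  0 < lambda ->
  0 < alpha -> alpha <= 2 ->
  `|theta| <= Num.min (pi * alpha / 2) (pi - pi * alpha / 2) ->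
  is_generalized_linnik lambda alpha theta (1 / k%:R) P ->
  P `<< (@lebesgue_measure R).
Proof.
move=> k1 lambda0 alpha0 _ thetale.
apply: linnik_null_dominates => //; first by rewrite divr_gt0// ltr0n.
(* The two bounds on |theta| add up to pi, so |theta| <= pi/2. *)
apply: cos_ge0_pihalf; rewrite -ler_norml.
by move: thetale; rewrite le_min => /andP[]; lra.
Qed.
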